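(* Let $d>0$, $p\in(0,1]$, $\rho\in(0,1]$ and $W\ge 0$. Consider the average-cost problem $$\min_{\phi\in\Phi}\ \limsup_{T\to+\infty}\frac1T\,\mathbb{E}^{\phi}\Big(\sum_{t=0}^{T-1}\big(s^{\phi}(t)+W a^{\phi}(t)\big)\,\Big|\,s(0)\Big)$$ for the Markov decision process with state space $\{b^j=dp\,j(j+1)/2 : j\in\mathbb{N}\}$ and actions $\{0,1\}$ described in the context. The optimal solution of this problem is an increasing threshold policy: there exists $n\in\mathbb{N}$ such that the stationary policy that takes the passive action ($a=0$) whenever the current state $b^j$ satisfies $b^j<b^n$, and the active action ($a=1$) whenever the current state satisfies $b^j\ge b^n$, is optimal (for every initial state $s(0)$).
   Context: $\mathbb{N}=\{0,1,2,\dots\}$. The Markov decision process is as follows. States: $b^j=dp\,\frac{j(j+1)}{2}$, $j\in\mathbb{N}$. Actions: $a(t)\in\{0,1\}$, where $1$ (active) means the user is scheduled and $0$ (passive) means it is not. Transitions: from state $b^j$ under action $0$ the next state is $b^{j+1}$ with probability $1$; under action $1$ the next state is $b^0$ with probability $\rho$ and $b^{j+1}$ with probability $1-\rho$. Instantaneous cost: $s(t)+W a(t)$. $\Phi$ is the set of all causal policies (the action at time $t$ may depend on the past and present states and past actions); $s^\phi(t)$ and $a^\phi(t)$ denote the state and action at time $t$ under $\phi$. A policy is optimal if it attains the minimum of the displayed average cost over $\Phi$. *)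

(* Defs.v *)
From mathcomp Require Import all_boot all_order all_algebra.
From mathcomp Require Import all_classical all_reals all_analysis.

Set Implicit Arguments.
Unset Strict Implicit.
Unset Printing Implicit Defensive.

Import Order.TTheory GRing.Theory Num.Theory.

Local Open Scope classical_set_scope.
Local Open Scope ring_scope.

(* The state b^j is encoded by its index j (j |-> b^j is injective when
   d, p > 0), and an action by a boolean, true being the active action. *)

Definition state_val (R : realType) (d p : R) (j : nat) : R :=
  d * p * (j%:R * (j.+1)%:R / 2).

Definition trans (R : realType) (rho : R) (j : nat) (a : bool) (k : nat) : R :=
  if a then rho * (k == 0%N)%:R + (1 - rho) * (k == j.+1)%:R
  else (k == j.+1)%:R.

(* Successive (state, action) pairs, MOST RECENT FIRST: the list
   [:: (j_(T-1), a_(T-1)); ...; (j_0, a_0)] records the times 0, ..., T-1. *)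
Definition history := seq (nat * bool).

(* Causal policies may randomize: [act_prob h j] is the probability of taking
   the active action in the present state [j] after the past [h]. *)
Record policy (R : realType) := Policy {
  act_prob :> history -> nat -> R ;
  act_prob_itv : forall h j, 0 <= act_prob h j <= 1 }.

Lemma det_policy_itv (R : realType) (f : nat -> bool) (h : history) (j : nat) :
  0 <= ((f j)%:R : R) <= 1.
Proof. by rewrite ler0n lern1 leq_b1. Qed.

Definition stationary_policy (R : realType) (f : nat -> bool) : policy R :=
  Policy (det_policy_itv R f).

Definition threshold_policy (R : realType) (d p : R) (n : nat) : policy R :=
  stationary_policy R (fun j => state_val d p n <= state_val d p j).

Definition action_law (R : realType) (phi : policy R) (h : history) (j : nat)
    (a : bool) : R :=
  if a then phi h j else 1 - phi h j.

Definition state_law (R : realType) (rho : R) (i : nat) (h : history)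
    (j : nat) : R :=
  if h is (k, a) :: _ then trans rho k a j else (j == i)%:R.

(* Probability, under [phi] and given s(0) = b^i, that [h] is the sequence of
   the first [size h] state-action pairs. *)
Fixpoint history_prob (R : realType) (rho : R) (phi : policy R) (i : nat)
    (h : history) : R :=
  if h is (j, a) :: past then
    history_prob rho phi i past * state_law rho i past j
      * action_law phi past j a
  else 1.

(* Expectation of a nonnegative function of the first [T] state-action pairs;
   [\esum] is the sum, in the extended reals, of a nonnegative family. *)
Definition expect (R : realType) (rho : R) (phi : policy R) (i T : nat)
    (X : history -> R) : \bar R :=
  \esum_(h in [set h : history | size h = T]) (history_prob rho phi i h * X h)%:E.

Definition total_cost (R : realType) (d p W : R) (h : history) : R :=
  \sum_(x <- h) (state_val d p x.1 + W * x.2%:R).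

Definition average_cost (R : realType) (d p rho W : R) (phi : policy R)
    (i : nat) : \bar R :=
  limn_esup (fun T : nat =>
    ((T%:R^-1)%:E * expect rho phi i T (total_cost d p W))%E).

Definition optimal_policy (R : realType) (d p rho W : R) (phi : policy R) :
    Prop :=
  forall (i : nat) (psi : policy R),
    (average_cost d p rho W phi i <= average_cost d p rho W psi i)%E.

(* Main.v *)
(* Suppose that a gain g and a function V solve the average-cost Bellman equation
     V j + g = min_a (b^j + W a + E [V (next state)]),
   with 0 <= V j <= A b^j + B. Telescoping, x_T + E V(s(T)) >= V(i) + g T for the
   expected total cost x_T of any policy, with equality for a policy choosing a
   minimizing action in every state. Since moreover
   E V(s(T)) <= A E b^(s(T)) + B <= A (x_(T+1) - x_T) + B,
   the sequence x_T - g T is bounded below, so that g is the optimal average cost.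

   For the threshold n and V 0 = 0, the evaluation equations are solved
   explicitly. The minimality of the threshold action amounts to V j <= W / rho
   for j <= n and V j >= W / rho for j > n, and this holds for the least n
   at which the threshold n does at least as well as n + 1. *)

Require Import Defs.
From mathcomp Require Import all_boot all_order all_algebra.
From mathcomp Require Import all_classical all_reals all_analysis.
From mathcomp Require Import ring lra.

Set Implicit Arguments.
Unset Strict Implicit.
Unset Printing Implicit Defensive.

Import Order.TTheory GRing.Theory Num.Theory.
Import numFieldNormedType.Exports.

Local Open Scope classical_set_scope.
Local Open Scope ring_scope.

(* Duplicate-free lists supporting the laws of the next state, of the next
   state-action pair and of the history at time [T]; expectations are therefore
   finite sums. *)
Definition succ_states (i : nat) (h : history) : seq nat :=
  if h is (k, _) :: _ then [:: 0%N; k.+1] else [:: i].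

Definition steps (i : nat) (h : history) : seq (nat * bool) :=
  [seq (j, a) | j <- succ_states i h, a <- [:: true; false]].

Fixpoint paths (i T : nat) : seq history :=
  if T is T'.+1 then [seq x :: h | h <- paths i T', x <- steps i h]
  else [:: [::]].

Lemma uniq_steps i h : uniq (steps i h).
Proof. by case: h => [|[k a] h]; rewrite /= !inE !xpair_eqE !andbF. Qed.

Lemma mem_steps i h x : (x \in steps i h) = (x.1 \in succ_states i h).
Proof.
apply/idP/idP => [/allpairsPdep[j [a [? _ ->]]]//|].
by case: x => j a /= xi; apply/allpairsPdep; exists j, a; split=> //; case: (a).
Qed.

Lemma uniq_paths i T : uniq (paths i T).
Proof.
elim: T => [//|T IH] /=; apply: allpairs_uniq_dep => //.
  by move=> h _; exact: uniq_steps.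
by move=> [h x] [h' x'] _ _ /= [-> ->].
Qed.

Lemma size_paths i T h : h \in paths i T -> size h = T.
Proof.
elim: T h => [|T IH] h /=; first by rewrite inE => /eqP ->.
by move=> /allpairsPdep[h' [x [/IH <- _ ->]]].
Qed.

(** * Laws of histories and expectations as finite sums *)

Section law.
Variables (R : realType) (rho : R) (phi : policy R) (i : nat).
Hypothesis rho_itv : 0 < rho <= 1.

(** Conditional expectation given the past [h], over the present state, before the action is
    drawn. *)
Definition next_mean (h : history) (F : nat -> R) : R :=
  \sum_(j <- succ_states i h) state_law rho i h j * F j.

Definition mean (T : nat) (F : history -> R) : R :=
  \sum_(h <- paths i T) history_prob rho phi i h * F h.

Lemma next_mean_cons j a h F : next_mean ((j, a) :: h) F =
  if a then rho * F 0%N + (1 - rho) * F j.+1 else F j.+1.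
Proof.
rewrite /next_mean /= big_cons big_seq1 /trans /= eqxx; case: a => /=; ring.
Qed.

Lemma state_law_ge0 h j : 0 <= state_law rho i h j.
Proof.
case: h => [|[k a] h] /=; first exact: ler0n.
rewrite /trans; case: a; last exact: ler0n.
by case/andP: rho_itv => *; rewrite addr_ge0 // mulr_ge0 ?ler0n //; lra.
Qed.

Lemma action_law_ge0 h j a : 0 <= action_law phi h j a.
Proof. by rewrite /action_law; have := act_prob_itv phi h j; case: a; lra. Qed.

Lemma history_prob_ge0 h : 0 <= history_prob rho phi i h.
Proof.
elim: h => [|[j a] h IH] //=.
by rewrite !mulr_ge0 ?state_law_ge0 ?action_law_ge0.
Qed.

Lemma next_mean_const h (c : R) : next_mean h (fun=> c) = c.
Proof.
case: h => [|[j a] h]; last by rewrite next_mean_cons; case: a; ring.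
by rewrite /next_mean /= big_seq1 eqxx mul1r.
Qed.

Lemma le_next_mean h F G : (forall j, F j <= G j) ->
  next_mean h F <= next_mean h G.
Proof.
by move=> FG; apply: ler_sum => j _; rewrite ler_wpM2l ?state_law_ge0.
Qed.

Lemma next_meanD h F G :
  next_mean h (fun j => F j + G j) = next_mean h F + next_mean h G.
Proof. by rewrite -big_split; apply: eq_bigr => j _; rewrite mulrDr. Qed.

Lemma next_meanZ h c F : next_mean h (fun j => c * F j) = c * next_mean h F.
Proof. by rewrite /next_mean mulr_sumr; apply: eq_bigr => j _; rewrite mulrCA. Qed.

Lemma le_mean T F G : (forall h, F h <= G h) -> mean T F <= mean T G.
Proof.
by move=> FG; apply: ler_sum => h _; rewrite ler_wpM2l ?history_prob_ge0.
Qed.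

Lemma eq_mean T F G : F =1 G -> mean T F = mean T G.
Proof. by move=> FG; apply: eq_bigr => h _; rewrite FG. Qed.

Lemma meanD T F G :
  mean T (fun h => F h + G h) = mean T F + mean T G.
Proof. by rewrite -big_split; apply: eq_bigr => h _; rewrite mulrDr. Qed.

Lemma meanZ T c F : mean T (fun h => c * F h) = c * mean T F.
Proof. by rewrite /mean mulr_sumr; apply: eq_bigr => h _; rewrite mulrCA. Qed.

Lemma mean0 F : mean 0 F = F [::].
Proof. by rewrite /mean big_seq1 mul1r. Qed.

(** Tower property: average over the past, then the present state, then the action. *)
Lemma meanS T F : mean T.+1 F = mean T (fun h => next_mean h (fun j =>
  phi h j * F ((j, true) :: h) + (1 - phi h j) * F ((j, false) :: h))).
Proof.
rewrite /mean /= big_allpairs_dep; apply: eq_bigr => h _.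
rewrite big_allpairs_dep mulr_sumr; apply: eq_bigr => j _.
by rewrite big_cons big_seq1 /=; ring.
Qed.

Lemma mean_const T (c : R) : mean T (fun=> c) = c.
Proof.
elim: T => [|T IH]; first by rewrite mean0.
rewrite meanS -[RHS]IH; apply: eq_mean => h.
by rewrite -[RHS](next_mean_const h); apply: eq_bigr => j _; ring.
Qed.

Lemma history_prob_notin h :
  h \notin paths i (size h) -> history_prob rho phi i h = 0.
Proof.
elim: h => [//|[j a] h IH] /=.
have [hP|/IH -> _] := boolP (h \in paths i (size h)); last by rewrite !mul0r.
move=> hN; suff -> : state_law rho i h j = 0 by rewrite mulr0 mul0r.
have : j \notin succ_states i h.
  apply: contra hN => jh; apply/allpairsPdep; exists h, (j, a); split=> //.
  by rewrite mem_steps.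
case: h {IH hP hN} => [|[k b] h] /=; first by rewrite inE => /negbTE ->.
rewrite !inE negb_or => /andP[/negbTE j0 /negbTE jk]; rewrite /trans j0 jk.
by case: b; rewrite /= mulr0n ?mulr0 ?addr0.
Qed.

(** Histories of length [T] outside [paths i T] have probability zero. *)
Lemma expect_mean T X : (forall h, 0 <= X h) ->
  expect rho phi i T X = (mean T X)%:E.
Proof.
move=> X0; rewrite /expect (esumID [set` paths i T]); last first.
  by move=> h _; rewrite lee_fin mulr_ge0 ?history_prob_ge0.
rewrite [X in (_ + X)%E]esum1 ?adde0; last first.
  move=> h [/= <- /negP hN]; rewrite history_prob_notin ?mul0r //.
rewrite (_ : _ `&` _ = [set` paths i T]); last first.
  by apply/setIidPr => h; exact: size_paths.
rewrite esum_fset; [|exact: finite_seq|]; last first.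
  by move=> h _; rewrite lee_fin mulr_ge0 ?history_prob_ge0.
by rewrite /mean -sumEFin [RHS](fsbig_seq _ _ (uniq_paths i T)).
Qed.

End law.

Definition bellman_rhs (R : realType) (d p rho W : R) (V : nat -> R) (j : nat)
    (a : bool) : R :=
  state_val d p j + W * a%:R
    + (if a then rho * V 0%N + (1 - rho) * V j.+1 else V j.+1).

(** * Upper limits of time averages *)

Section limsup.
Variable R : realType.

Lemma le_limn_esup (u v : (\bar R)^nat) :
  (forall n, (u n <= v n)%E) -> (limn_esup u <= limn_esup v)%E.
Proof.
move=> uv; rewrite !limn_esup_lim; apply: lee_lim; [exact: is_cvg_esups..|].
apply: nearW => n; apply: ge_ereal_sup => _ [m /= nm <-].
by apply: le_trans (uv m) _; apply: ereal_sup_ubound; exists m.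
Qed.

Lemma limn_esup_average (g C : R) :
  limn_esup (fun T : nat => ((T%:R^-1)%:E * (g * T%:R + C)%:E)%E) = g%:E.
Proof.
suff h : (fun T : nat => ((T%:R^-1)%:E * (g * T%:R + C)%:E)%E) @ \oo --> g%:E.
  by rewrite is_cvg_limn_esupE; [exact: cvg_lim|apply/cvg_ex; exists g%:E].
(* The shift discards [T = 0], where the inverse is 0 by convention. *)
rewrite -cvg_shiftS; apply: cvg_EFin; first exact: nearW.
rewrite (_ : _ \o _ = fun n => g + C * harmonic n); last first.
  by apply/funext => n /=; field; rewrite nat1r pnatr_eq0.
rewrite -[X in _ --> X]addr0 -(mulr0 C).
apply: cvgD; first exact: cvg_cst.
by apply: cvgM; [exact: cvg_cst|exact: cvg_harmonic].
Qed.

End limsup.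

(** * From a solution of the Bellman equation to optimality *)

Section verification.
Variables (R : realType) (d p rho W : R).
Hypotheses (d_gt0 : 0 < d) (p_gt0 : 0 < p) (rho_itv : 0 < rho <= 1)
  (W_ge0 : 0 <= W).

Let c := state_val d p.
Let Q := bellman_rhs d p rho W.

Lemma state_val_ge0 j : 0 <= c j.
Proof. by rewrite /c /state_val !mulr_ge0 // ?ltW // ?invr_gt0. Qed.

Lemma total_cost_cons j a h :
  total_cost d p W ((j, a) :: h) = c j + W * a%:R + total_cost d p W h.
Proof. by rewrite /total_cost big_cons. Qed.

Lemma total_cost_ge0 h : 0 <= total_cost d p W h.
Proof.
by apply: sumr_ge0 => x _; rewrite addr_ge0 ?state_val_ge0 // mulr_ge0 ?ler0n.
Qed.

(** Given the state and action at time [T], the cost then incurred plus the expected next value is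
    exactly [Q]. *)
Lemma potential_step (phi : policy R) i T V :
  mean rho phi i T.+1 (fun h => total_cost d p W h + next_mean rho i h V) =
  mean rho phi i T (fun h => next_mean rho i h (fun j =>
    phi h j * Q V j true + (1 - phi h j) * Q V j false + total_cost d p W h)).
Proof.
rewrite meanS; apply: eq_mean => h; apply: eq_bigr => j _; congr (_ * _).
rewrite !total_cost_cons !next_mean_cons /Q /bellman_rhs -/c /=; ring.
Qed.

(** Each step adds at least [g]: randomizing only averages the bounds for the two actions. *)
Lemma mean_potential_ge (phi : policy R) i V g T :
  (forall j a, V j + g <= Q V j a) ->
  V i + g * T%:R <=
  mean rho phi i T (fun h => total_cost d p W h + next_mean rho i h V).
Proof.
move=> VQ; elim: T => [|T IH].
  rewrite mean0 /total_cost big_nil /next_mean /= big_seq1 eqxx.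
  by rewrite mul1r mulr0 addr0 add0r.
rewrite potential_step mulrSr mulrDr mulr1 addrA.
apply: le_trans (lerD IH (lexx g)) _.
rewrite -[X in _ + X](mean_const rho phi i T) -meanD.
apply: le_mean => // h.
rewrite addrAC -addrA.
rewrite (_ : _ + _ = next_mean rho i h (fun j => V j + (total_cost d p W h + g))).
  apply: le_next_mean => // j; have := VQ j true; have := VQ j false.
  have := act_prob_itv phi h j; nra.
by rewrite next_meanD next_mean_const; ring.
Qed.

Lemma mean_potential_eq (f : nat -> bool) i V g T :
  (forall j, V j + g = Q V j (f j)) ->
  mean rho (stationary_policy R f) i T
    (fun h => total_cost d p W h + next_mean rho i h V) = V i + g * T%:R.
Proof.
move=> VQ; elim: T => [|T IH].
  rewrite mean0 /total_cost big_nil /next_mean /= big_seq1 eqxx.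
  by rewrite mul1r mulr0 addr0 add0r.
rewrite potential_step mulrSr mulrDr mulr1 addrA -IH.
rewrite -[X in _ + X](mean_const rho (stationary_policy R f) i T) -meanD.
apply: eq_mean => h.
rewrite [RHS](_ : _ = next_mean rho i h (fun j => V j + (total_cost d p W h + g))).
  apply: eq_bigr => j _; congr (_ * _); rewrite addrCA VQ /=.
  by case: (f j) => /=; rewrite ?mulr1n ?mulr0n; ring.
by rewrite next_meanD next_mean_const; ring.
Qed.

Lemma mean_cost_growth (phi : policy R) i T :
  mean rho phi i T (total_cost d p W) + mean rho phi i T (next_mean rho i ^~ c)
  <= mean rho phi i T.+1 (total_cost d p W).
Proof.
rewrite meanS -meanD; apply: le_mean => // h.
rewrite -{1}(next_mean_const rho i h (total_cost d p W h)) -next_meanD.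
apply: le_next_mean => // j; rewrite !total_cost_cons -/c /= mulr1 mulr0.
have /andP[ph0 _] := act_prob_itv phi h j; have := mulr_ge0 ph0 W_ge0; lra.
Qed.

(* [g T - C] is preserved by the recursion
   [A x_(T+1) >= (A - 1) x_T + g T - B] for [C = A g + B]; it replaces a
   growth condition on [E V(s(T))], which an arbitrary policy need not satisfy. *)
Lemma mean_cost_ge (phi : policy R) i V g A B :
  1 <= A -> 0 <= g -> 0 <= B ->
  (forall j, 0 <= V j <= A * c j + B) -> (forall j a, V j + g <= Q V j a) ->
  exists C, forall T, g * T%:R - C <= mean rho phi i T (total_cost d p W).
Proof.
move=> A1 g0 B0 VA VQ; exists (A * g + B); elim=> [|T IH].
  by rewrite mean0 /total_cost big_nil; nra.
have pot := mean_potential_ge phi i T VQ.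
have grow := mean_cost_growth phi i T.
have UA : mean rho phi i T (next_mean rho i ^~ V) <=
    A * mean rho phi i T (next_mean rho i ^~ c) + B.
  rewrite -[X in _ + X](mean_const rho phi i T) -meanZ -meanD.
  apply: le_mean => // h; rewrite -(next_mean_const rho i h B).
  rewrite -next_meanZ -next_meanD; apply: le_next_mean => // j.
  by have /andP[] := VA j.
rewrite meanD in pot; have /andP[Vi0 _] := VA i.
set x := mean _ _ _ T (total_cost _ _ _) in IH pot grow *.
set x' := mean _ _ _ T.+1 _ in grow *.
set U := mean _ _ _ _ (fun h => next_mean _ _ h V) in pot UA *.
set K := mean _ _ _ _ (fun h => next_mean _ _ h c) in UA grow *.
rewrite mulrSr; set t := T%:R in IH pot *.
(* By [grow], [UA] and [pot], A x' >= A x + U - B >= (A - 1) x + g t - B; [IH] then applies as A >=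
   1. *)
have : A * (g * (t + 1) - (A * g + B)) <= A * x'.
  nra.
by rewrite ler_pM2l //; lra.
Qed.

Lemma average_cost_mean (phi : policy R) i : average_cost d p rho W phi i =
  limn_esup (fun T : nat =>
    ((T%:R^-1)%:E * (mean rho phi i T (total_cost d p W))%:E)%E).
Proof.
rewrite /average_cost; congr limn_esup; apply/funext => T.
by rewrite expect_mean //; exact: total_cost_ge0.
Qed.

(** As V >= 0, the cost of [f] is at most V i + g T, while any policy costs at least g T - C;
    divided by T, both bounds tend to g. *)
Lemma bellman_optimal (f : nat -> bool) V g A B :
  1 <= A -> 0 <= g -> 0 <= B -> (forall j, 0 <= V j <= A * c j + B) ->
  (forall j a, V j + g <= Q V j a) -> (forall j, V j + g = Q V j (f j)) ->
  optimal_policy d p rho W (stationary_policy R f).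
Proof.
move=> A1 g0 B0 VA VQ VQf i psi; apply: (@le_trans _ _ g%:E).
  rewrite -(limn_esup_average g (V i)) average_cost_mean.
  apply: le_limn_esup => T; rewrite -!EFinM lee_fin.
  rewrite ler_wpM2l ?invr_ge0 // addrC -(mean_potential_eq i T VQf).
  apply: le_mean => // h; rewrite lerDl -(next_mean_const rho i h 0).
  by apply: le_next_mean => // j; have /andP[] := VA j.
have [C xC] := mean_cost_ge psi i A1 g0 B0 VA VQ.
rewrite -(limn_esup_average g (- C)) average_cost_mean.
apply: le_limn_esup => T; rewrite -!EFinM lee_fin.
by rewrite ler_wpM2l ?invr_ge0.
Qed.

End verification.

(** * Gain and relative values of threshold policies, and choice of the threshold *)

Section threshold.
Variables (R : realType) (d p rho W : R).
Hypotheses (d_gt0 : 0 < d) (p_gt0 : 0 < p) (rho_itv : 0 < rho <= 1).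

Let c := state_val d p.
Let r := (1 - rho) / rho.

Let rho_gt0 : 0 < rho. Proof. by case/andP: rho_itv. Qed.
Let rho_neq0 : rho != 0. Proof. exact: lt0r_neq0. Qed.
Let r_ge0 : 0 <= r.
Proof. by case/andP: rho_itv => ? ?; rewrite /r divr_ge0 // ?subr_ge0 // ltW. Qed.
Let dp_gt0 : 0 < d * p. Proof. exact: mulr_gt0. Qed.

Definition passive_cost (n : nat) : R := \sum_(k < n) c k.

(* Closed form of [\sum_k (1 - rho)^k b^(j+k)], the expected sum of the
   visited states from [b^j] until the next return to [b^0] when always active. *)
Definition active_cost (j : nat) : R :=
  (c j + r * (d * p) * j.+1%:R + r ^+ 2 * (d * p)) / rho.

(** Renewal-reward ratio over a cycle between visits to b^0: [n] passive steps, then 1 / rho active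
    ones on average. *)
Definition gain (n : nat) : R :=
  (passive_cost n + active_cost n + W / rho) / (n%:R + rho^-1).

(** Normalized to vanish at 0. The second branch is the expected cost, in excess of the gain, until
    the return to b^0. *)
Definition rel_value (n j : nat) : R :=
  if (j <= n)%N then gain n * j%:R - passive_cost j
  else active_cost j + (W - gain n) / rho.

(* The value of [W / rho] at which the thresholds [n] and [n.+1] have the same
   gain. *)
Definition switch_cost (n : nat) : R :=
  n.+1%:R * (rho * active_cost n.+1) - passive_cost n.+1.

Lemma state_valS j : c j.+1 = c j + d * p * j.+1%:R.
Proof. by rewrite /c /state_val -!natr1; field. Qed.

Lemma state_val_lt j k : (c j < c k) = (j < k)%N.
Proof.
have lec : {homo c : j k / (j < k)%N >-> j < k}.
  apply: homo_ltn => [x y z|i]; first exact: lt_trans.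
  by rewrite state_valS ltrDl mulr_gt0 ?ltr0n.
case: (ltnP j k) => [/lec //|]; rewrite leq_eqVlt => /predU1P[->|/lec kj].
  exact: ltxx.
by apply/negbTE; rewrite -leNgt ltW.
Qed.

Lemma state_val_le j k : (c j <= c k) = (j <= k)%N.
Proof. by rewrite leNgt state_val_lt -leqNgt. Qed.

Lemma passive_costS n : passive_cost n.+1 = passive_cost n + c n.
Proof. by rewrite /passive_cost big_ord_recr. Qed.

Lemma active_cost_rec j :
  active_cost j = c j + (1 - rho) * active_cost j.+1.
Proof. by rewrite /active_cost state_valS -!natr1 /r; field. Qed.

Lemma le_active_cost j k : (j <= k)%N -> active_cost j <= active_cost k.
Proof.
move=> jk; rewrite /active_cost ler_pM2r ?invr_gt0 // lerD2r lerD //.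
  by rewrite state_val_le.
by rewrite ler_wpM2l ?ler_nat // mulr_ge0 // ltW.
Qed.

Lemma active_cost_ge j : c j <= rho * active_cost j.
Proof.
rewrite /active_cost mulrC divfK // -addrA lerDl.
by rewrite addr_ge0 // mulr_ge0 ?sqr_ge0 ?(mulr_ge0 r_ge0) // ltW.
Qed.

(** Provides the affine bound on V by the state that verification requires. *)
Lemma active_cost_le j : active_cost j <= rho^-2 * c j + active_cost 0.
Proof.
have cj : d * p * j%:R <= c j.
  case: j => [|j]; first by rewrite mulr0 state_val_ge0.
  by rewrite state_valS lerDr state_val_ge0.
rewrite -subr_ge0 (_ : _ - _ = r / rho * (c j - d * p * j%:R)).
  by rewrite mulr_ge0 ?subr_ge0 // divr_ge0 // ltW.
by rewrite /active_cost /c /state_val /r -natr1; field.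
Qed.

(** The two branches of [rel_value] agree at [n]. *)
Lemma gainE n : gain n * n%:R - passive_cost n =
  active_cost n + (W - gain n) / rho.
Proof.
have : n%:R + rho^-1 != 0 by rewrite lt0r_neq0 // ltr_wpDl // invr_gt0.
move=> n0; have : gain n * (n%:R + rho^-1) =
  passive_cost n + active_cost n + W / rho by rewrite /gain divfK.
rewrite mulrDr mulrBl; lra.
Qed.

Lemma rel_value_passive n j : (j <= n)%N ->
  rel_value n j = gain n * j%:R - passive_cost j.
Proof. by rewrite /rel_value => ->. Qed.

Lemma rel_value_active n j : (n <= j)%N ->
  rel_value n j = active_cost j + (W - gain n) / rho.
Proof.
rewrite leq_eqVlt => /predU1P[<-|nj]; last by rewrite /rel_value leqNgt nj.
by rewrite rel_value_passive // gainE.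
Qed.

(** The left side says that [rel_value n n.+1] is at least W / rho: under threshold [n], acting in
    state [n] is minimizing. *)
Lemma gain_le n : (gain n <= rho * active_cost n.+1) = (W / rho <= switch_cost n).
Proof.
have n0 : 0 < n%:R + rho^-1 by rewrite ltr_wpDl // invr_gt0.
rewrite /gain ler_pdivrMr // /switch_cost -subr_ge0 -[in RHS]subr_ge0.
congr (0 <= _); rewrite passive_costS -natr1 (active_cost_rec n).
by field.
Qed.

(** Dually, the left side says that under threshold [n.+1] staying passive in state [n] is
    minimizing. *)
Lemma gain_ge n : (rho * active_cost n.+1 <= gain n.+1) = (switch_cost n <= W / rho).
Proof.
have n0 : 0 < n.+1%:R + rho^-1 by rewrite ltr_wpDl // invr_gt0.
rewrite /gain ler_pdivlMr // /switch_cost -subr_ge0 -[in RHS]subr_ge0.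
by congr (0 <= _); field.
Qed.

(** [switch_cost n] is at least (n + 1) (b^(n+1) - b^n) = d p (n + 1)^2. *)
Lemma switch_cost_unbounded (x : R) : exists n, x <= switch_cost n.
Proof.
exists (Num.bound (`|x| / (d * p))); set n := Num.bound _.
have xn : `|x| / (d * p) < n%:R by rewrite archi_boundP // divr_ge0 // ltW.
have Cn : passive_cost n.+1 <= n.+1%:R * c n.
  rewrite -[n.+1 in leRHS]card_ord mulr_natl -sumr_const.
  by apply: ler_sum => k _; rewrite state_val_le -ltnS.
apply: (@le_trans _ _ (n.+1%:R * (c n.+1 - c n))); last first.
  by rewrite /switch_cost mulrBr lerB // ler_wpM2l // active_cost_ge.
rewrite state_valS addrAC subrr add0r.
have := ler_norm x; rewrite ltr_pdivrMr // in xn.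
have n1 : 0 <= n%:R :> R by [].
rewrite -natr1 => ?; have := ltW dp_gt0; nra.
Qed.

(** Minimality of [n], read at n - 1, gives the second inequality; for n = 0 no state is passive. *)
Lemma threshold_switch : exists n, gain n <= rho * active_cost n.+1 /\
  ((0 < n)%N -> rho * active_cost n <= gain n).
Proof.
have [n Wn nmin] := ex_minnP (switch_cost_unbounded (W / rho)).
exists n; rewrite gain_le; split => //; case: n Wn nmin => [//|n] _ nmin _.
by rewrite gain_ge leNgt; apply/negP => /ltW /nmin; rewrite ltnn.
Qed.

End threshold.

(** * Optimality of the selected threshold *)

Theorem theorem1 (R : realType) (d p rho W : R)
    (d_gt0 : 0 < d) (p_itv : 0 < p <= 1) (rho_itv : 0 < rho <= 1)
    (W_ge0 : 0 <= W) :
  exists n : nat, optimal_policy d p rho W (threshold_policy d p n).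
Proof.
have /andP[p_gt0 _] := p_itv; have /andP[rho_gt0 rho_le1] := rho_itv.
have [n [g_le g_ge]] := threshold_switch W d_gt0 p_gt0 rho_itv.
exists n.
set P := active_cost d p rho in g_le g_ge.
set g := gain d p rho W n in g_le g_ge.
set V := rel_value d p rho W n; set c := state_val d p.
have wE : W / rho * rho = W by rewrite divfK ?lt0r_neq0.
have W_div : 0 <= W / rho by rewrite divr_ge0 // ltW.
have c0 j : 0 <= c j by exact: state_val_ge0.
have P0 j : 0 <= P j.
  rewrite -(pmulr_rge0 _ rho_gt0).
  exact: le_trans (c0 j) (active_cost_ge d_gt0 p_gt0 rho_itv j).
have g0 : 0 <= g.
  rewrite /g /gain divr_ge0 ?addr_ge0 ?invr_ge0 ?(ltW rho_gt0) ?sumr_ge0 //.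
have gP j : (n < j)%N -> g <= rho * P j.
  move=> nj; apply: le_trans g_le _.
  by rewrite ler_pM2l // le_active_cost.
(* Passive states cost at most [g] per step, so V is nondecreasing up to [n]. *)
have cg j : (j < n)%N -> c j <= g.
  move=> jn; apply: le_trans (g_ge (leq_ltn_trans _ jn)) => //.
  apply: le_trans (active_cost_ge d_gt0 p_gt0 rho_itv _) => //.
  by rewrite state_val_le // ltnW.
have Vstep j : (j < n)%N -> V j + g = c j + V j.+1.
  move=> jn; rewrite /V !rel_value_passive ?(ltnW jn) //.
  by rewrite passive_costS -natr1 -/g -/c; ring.
have V0 : V 0%N = 0.
  by rewrite /V rel_value_passive // /passive_cost big_ord0 mulr0 subr0.
have Vact j : (n <= j)%N -> V j + g = c j + W + (1 - rho) * V j.+1.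
  move=> nj; rewrite /V !rel_value_active ?leqW //.
  rewrite active_cost_rec // -/c -/g; field; exact: lt0r_neq0.
have V_gt j : (n < j)%N -> W / rho <= V j <= P j + W / rho.
  move=> nj; rewrite /V rel_value_active ?(ltnW nj) //.
  rewrite mulrBl -/g -/P; have := gP j nj.
  rewrite mulrC -ler_pdivrMr //.
  have : 0 <= g / rho by rewrite divr_ge0 // ltW.
  by move=> *; apply/andP; split; lra.
have V_mono j k : (j <= k)%N -> (k <= n)%N -> V j <= V k.
  elim: k => [|k IH]; first by rewrite leqn0 => /eqP ->.
  rewrite leq_eqVlt => /predU1P[-> //|jk] kn.
  apply: le_trans (IH jk (ltnW kn)) _.
  by have := Vstep k kn; have := cg k kn; lra.
have V_le j : (j <= n)%N -> 0 <= V j <= W / rho.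
  move=> jn; rewrite -[X in X <= _]V0 V_mono //=.
  (* For n = 0, [g_ge] is vacuous, but only V 0 = 0 has to be bounded. *)
  have [n0|n0] := posnP n.
    by move: jn; rewrite n0 leqn0 => /eqP ->; rewrite V0.
  apply: le_trans (V_mono j n jn _) _ => //.
  rewrite /V rel_value_active // mulrBl -/g -/P.
  by have := g_ge n0; rewrite mulrC -ler_pdivlMr //; lra.
(* The slope comes from [active_cost_le]; the constant also covers the bound W / rho for j <= n. *)
apply: (@bellman_optimal R d p rho W d_gt0 p_gt0 rho_itv W_ge0
  _ V g (rho^-2) (P 0%N + W / rho)) => //.
- by rewrite invf_ge1 ?exprn_gt0 // exprn_ile1 // ltW.
- by rewrite addr_ge0.
- move=> j; have r0 : 0 <= rho^-2 * c j.
    by rewrite mulr_ge0 // invr_ge0 exprn_ge0 // ltW.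
  have [jn|jn] := leqP j n.
    by have /andP[-> ?] := V_le j jn; have := P0 0%N; rewrite /= -/c; lra.
  have /andP[? ?] := V_gt j jn.
  have := active_cost_le d_gt0 p_gt0 rho_itv j; rewrite -/P -/c.
  by move=> *; apply/andP; split; lra.
(* As V 0 = 0, active minus passive is W - rho V (j + 1), and j >= n exactly when j + 1 > n. *)
- move=> j a; rewrite /bellman_rhs V0 -/c.
  have [nj|jn] := leqP n j.
    have := V_gt j.+1 nj; rewrite (Vact j nj) ler_pdivrMr // => /andP[? _].
    by case: a => /=; rewrite ?mulr1n ?mulr0n; lra.
  have := V_le j.+1 jn; rewrite (Vstep j jn) ler_pdivlMr // => /andP[_ ?].
  by case: a => /=; rewrite ?mulr1n ?mulr0n; lra.
- move=> j; rewrite /bellman_rhs V0 -/c state_val_le //.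
  have [nj|jn] := leqP n j.
    by rewrite (Vact j nj) /= mulr1n; lra.
  by rewrite (Vstep j jn) /= mulr0n; lra.
Qed.
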